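(* Let $G$ be an Abelian topological group and let $\pi:X\to Y$ be a tame extension of minimal $G$-systems. Consider the conditions: (1) $\pi$ is highly proximal; (2) $\pi$ is proximal; (3) every equicontinuous factor of $(X,G)$ factors through $\pi$. Then (1)$\Rightarrow$(2)$\Leftrightarrow$(3). Moreover, if $X$ is metrizable, or if $\pi$ is open and $Y$ is metrizable, then conditions (1), (2), (3) are all equivalent.
   Context: A $G$-system $(X,G)$ is a compact Hausdorff space $X$ with a continuous action of $G$; it is minimal if every orbit is dense. An extension (factor map) $\pi:X\to Y$ is a continuous surjective $G$-equivariant map. Let $R_\pi=\{(x_1,x_2)\in X^2:\pi(x_1)=\pi(x_2)\}$ and $\Delta_2(X)=\{(x,x)\}$. For subsets $A_1,A_2\subseteq X$, $J\subseteq G$ is an independence set if for every nonempty finite $I\subseteq J$ and $\sigma:I\to\{1,2\}$, $\bigcap_{s\in I}s^{-1}A_{\sigma(s)}\neq\emptyset$; ${\rm IT}_2(X,G)$ is the set of pairs $(x,y)$ such that for all neighbourhoods $U\ni x$, $V\ni y$, $(U,V)$ has an infinite independence set. $\pi$ is tame if $({\rm IT}_2(X,G)\cap R_\pi)\setminus\Delta_2(X)=\emptyset$. $\pi$ is proximal if every pair $(x_1,x_2)\in R_\pi$ is proximal, i.e., the orbit closure $\overline{G(x_1,x_2)}$ meets $\Delta_2(X)$. $\pi$ is highly proximal if for every nonempty open $U\subseteq X$ and every $z\in Y$ there exists $s\in G$ with $\pi^{-1}(z)\subseteq sU$. A system $(W,G)$ is equicontinuous if the family of maps $w\mapsto sw$,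 $s\in G$, is equicontinuous with respect to the unique uniformity of $W$. Condition (3) means: for every extension $\theta:X\to W$ with $(W,G)$ equicontinuous there is an extension $\theta':Y\to W$ with $\theta=\theta'\circ\pi$. *)

(* Defs.v *)
From HB Require Import structures.
From mathcomp Require Import all_boot all_order all_algebra.
From mathcomp Require Import all_classical all_reals all_analysis.
From mathcomp Require Import Rstruct.
Set Implicit Arguments. Unset Strict Implicit. Unset Printing Implicit Defensive.
Import Order.TTheory GRing.Theory Num.Theory.
Local Open Scope classical_set_scope.
Local Open Scope ring_scope.

Definition Gsystem (G : topologicalZmodType) (X : topologicalType)
  (act : G -> X -> X) : Prop :=
  [/\ compact [set: X], hausdorff_space X,
      continuous (fun p : G * X => act p.1 p.2),
      (forall x, act 0 x = x) &
      (forall g h x, act (g + h) x = act g (act h x))].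

Definition orbit (G : topologicalZmodType) (X : Type) (act : G -> X -> X)
  (x : X) : set X := [set act g x | g in [set: G]].

Definition minimal (G : topologicalZmodType) (X : topologicalType)
  (act : G -> X -> X) : Prop :=
  forall x : X, closure (orbit act x) = [set: X].

Definition extension (G : topologicalZmodType) (X Y : topologicalType)
  (actX : G -> X -> X) (actY : G -> Y -> Y) (pi : X -> Y) : Prop :=
  [/\ continuous pi, (forall y, exists x, pi x = y) &
      (forall g x, pi (actX g x) = actY g (pi x))].

(* J is an independence set for (A1, A2); sigma : G -> bool encodes
   sigma : I -> {1,2} (true ~ 1, false ~ 2). *)
Definition indep_set (G : topologicalZmodType) (X : Type)
  (act : G -> X -> X) (A1 A2 : set X) (J : set G) : Prop :=
  forall (I : set G) (sigma : G -> bool),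
    finite_set I -> I !=set0 -> I `<=` J ->
    \bigcap_(s in I) (act s @^-1` (if sigma s then A1 else A2)) !=set0.

Definition IT2 (G : topologicalZmodType) (X : topologicalType)
  (act : G -> X -> X) (x y : X) : Prop :=
  forall U V : set X, nbhs x U -> nbhs y V ->
    exists J : set G, infinite_set J /\ indep_set act U V J.

Definition tame (G : topologicalZmodType) (X Y : topologicalType)
  (actX : G -> X -> X) (pi : X -> Y) : Prop :=
  forall x1 x2 : X, pi x1 = pi x2 -> IT2 actX x1 x2 -> x1 = x2.

Definition proximal_pair (G : topologicalZmodType) (X : topologicalType)
  (act : G -> X -> X) (x1 x2 : X) : Prop :=
  exists x : X,
    closure [set (act g x1, act g x2) | g in [set: G]] (x, x).

Definition proximal_ext (G : topologicalZmodType) (X Y : topologicalType)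
  (actX : G -> X -> X) (pi : X -> Y) : Prop :=
  forall x1 x2 : X, pi x1 = pi x2 -> proximal_pair actX x1 x2.

Definition highly_proximal (G : topologicalZmodType) (X Y : topologicalType)
  (actX : G -> X -> X) (pi : X -> Y) : Prop :=
  forall U : set X, open U -> U !=set0 ->
    forall z : Y, exists s : G, pi @^-1` [set z] `<=` actX s @` U.

(* Equicontinuity w.r.t. the uniformity of W (for compact Hausdorff W this
   is the unique uniformity compatible with its topology). *)
Definition equicontinuous_sys (G : topologicalZmodType) (W : uniformType)
  (act : G -> W -> W) : Prop :=
  forall E, entourage E -> exists2 D, entourage D &
    forall (s : G) (w1 w2 : W), D (w1, w2) -> E (act s w1, act s w2).

Definition equicont_factors_through (G : topologicalZmodType)
  (X Y : topologicalType) (actX : G -> X -> X) (actY : G -> Y -> Y)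
  (pi : X -> Y) : Prop :=
  forall (W : uniformType) (actW : G -> W -> W) (theta : X -> W),
    Gsystem actW -> equicontinuous_sys actW -> extension actX actW theta ->
    exists theta' : Y -> W,
      extension actY actW theta' /\ theta = theta' \o pi.

Definition open_map (X Y : topologicalType) (f : X -> Y) : Prop :=
  forall U : set X, open U -> open (f @` U).

Definition metrizable (X : topologicalType) : Prop :=
  exists d : X -> X -> Rdefinitions.R,
    [/\ (forall x y, d x y = 0 <-> x = y),
        (forall x y, d x y = d y x),
        (forall x y z, d x z <= d x y + d y z) &
        (forall (x : X) (A : set X),
            nbhs x A <-> exists2 e : Rdefinitions.R, 0 < e & [set y | d x y < e] `<=` A)].

(* Main.v *)
From HB Require Import structures.
Require Import Defs.
From mathcomp Require Import all_boot all_order all_algebra.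
From mathcomp Require Import all_classical all_reals all_analysis.
From mathcomp Require Import Rstruct lra.
Set Implicit Arguments. Unset Strict Implicit. Unset Printing Implicit Defensive.
Import Order.TTheory GRing.Theory Num.Theory.
Import numFieldNormedType.Exports.
Local Open Scope classical_set_scope.
Local Open Scope ring_scope.

(** The implications (1) => (2) => (3) are soft; the point is (3) => (1).

    An invariant mean on a power of [G] turns any [G]-invariant recurrence
    pattern into a continuous invariant pseudometric on [X], hence into an
    equicontinuous factor, which by (3) cannot separate points of a fibre of
    [pi].  Consequently, given nonempty open sets [A i] and [E i] (finitely many)
    with [E i] contained in [pi^-1 (pi (A i))], a single [s] moves each [A i]
    onto a set meeting [E i].  Iterating this on the [2^n] cells cut out by
    [s_1, ..., s_n] builds an infinite independence set for [(U1, U2)] as soon as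
    [pi U1 `&` pi U2] has nonempty interior.  By tameness, two distinct points of
    a fibre therefore have neighbourhoods whose images meet in a nowhere dense
    set; by compactness, a closed [C] inside an open [U] has a closed nowhere
    dense set in [Y] outside which every fibre meeting [C] lies in [U].  Such a
    fibre exists because [pi C] has nonempty interior, and minimality of [Y]
    carries every other fibre into [U]. *)

(** * Invariant means on abelian groups *)

(** If [Q K] failed, the sets whose complement in [K] satisfies [Q] would form a proper filter
    containing [K]; a cluster point of it has a neighbourhood satisfying [Q], a contradiction. *)
Lemma compact_ind (T : topologicalType) (K : set T) (Q : set T -> Prop) :
  compact K -> Q set0 -> (forall A B, A `<=` B -> Q B -> Q A) ->
  (forall A B, Q A -> Q B -> Q (A `|` B)) ->
  (forall p, K p -> exists2 O, nbhs p O & Q O) -> Q K.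
Proof.
move=> cK Q0 QS QU Qloc; apply: contrapT => nQ.
have FF : ProperFilter [set A | Q (K `\` A)].
  split; first by rewrite /= setD0.
  split => /=.
  - by rewrite setDT.
  - move=> A B QA QB; apply: QS (QU _ _ QA QB) => x [Kx nABx].
    by have [Ax|nAx] := pselect (A x); [right|left]; split => // Bx; apply: nABx.
  - by move=> A B AB; apply: QS => x [Kx nBx]; split => // /AB.
have [|p [Kp clp]] := cK _ FF; first by rewrite /= setDv.
have [V pV QV] := Qloc p Kp.
have /clp/(_ pV) : Q (K `\` ~` V) by apply: QS QV => x [_ /contrapT].
by case=> x [].
Qed.

(** The average of [phi] over the sums of [g *+ i], one independent [i <= n] for each entry [g] of
    [F]. These boxes play the role of Folner sets. *)
Fixpoint box_average (R : realType) (H : zmodType) (n : nat) (F : seq H)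
    (phi : H -> R) : R :=
  if F is g :: F'
  then box_average n F' (fun h => n.+1%:R^-1 * \sum_(i < n.+1) phi (h + g *+ i))
  else phi 0.

Section box_average_theory.
Context (R : realType) (H : zmodType) (n : nat).
Implicit Types (F : seq H) (phi psi : H -> R).

Lemma box_averageD F phi psi :
  box_average n F (fun h => phi h + psi h) =
  box_average n F phi + box_average n F psi.
Proof.
elim: F phi psi => //= g F IH phi psi; rewrite -IH; congr box_average.
by apply/funext => h; rewrite big_split mulrDr.
Qed.

Lemma box_average_cst F (c : R) : box_average n F (fun=> c) = c.
Proof.
elim: F c => //= g F IH c; rewrite -[RHS]IH; congr box_average.
apply/funext => h; rewrite sumr_const card_ord -[c *+ _]mulr_natl mulKf//.
Qed.

Lemma le_box_average F phi psi : (forall h, phi h <= psi h) ->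
  box_average n F phi <= box_average n F psi.
Proof.
elim: F phi psi => //= g F IH phi psi le; apply: IH => h.
by rewrite ler_wpM2l ?invr_ge0 ?ler0n//; apply: ler_sum.
Qed.

(** In direction [g] the two sums telescope to end terms in [[0, 1]] of weight [n.+1%:R^-1];
    averaging in the other directions commutes with the shift because [H] is abelian. *)
Lemma box_average_shift F phi g : g \in F -> (forall h, 0 <= phi h <= 1) ->
  box_average n F (fun h => phi (h + g)) <= box_average n F phi + n.+1%:R^-1.
Proof.
elim: F phi => // k F IH phi; rewrite inE => /orP[/eqP ->|gF] phi01 /=.
  rewrite -[X in _ <= _ + X](box_average_cst F) -box_averageD.
  apply: le_box_average => h.
  rewrite -[X in _ + X]mulr1 -mulrDr ler_wpM2l ?invr_ge0//.
  rewrite big_ord_recr big_ord_recl/= mulr0n addr0.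
  have -> : \sum_(i < n) phi (h + k *+ i + k) =
            \sum_(i < n) phi (h + k *+ bump 0 i).
    by apply: eq_bigr => i _; rewrite -addrA -mulrSr.
  have := phi01 (h + k *+ n + k); have := phi01 h.
  rewrite -?mulrSr => /andP[? ?] /andP[? ?]. lra.
have := IH (fun h => n.+1%:R^-1 * \sum_(i < n.+1) phi (h + k *+ i)) gF.
have -> : (fun h => n.+1%:R^-1 * \sum_(i < n.+1) phi (h + k *+ i + g)) =
   (fun h => n.+1%:R^-1 * \sum_(i < n.+1) phi (h + g + k *+ i)).
  by apply/funext => h; congr (_ * _); apply: eq_bigr => i _; rewrite addrAC.
apply=> h; apply/andP; split.
  by rewrite mulr_ge0 ?invr_ge0// sumr_ge0// => i _; case/andP: (phi01 (h + k *+ i)).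
rewrite -[leRHS](@mulVf _ n.+1%:R)// ler_wpM2l ?invr_ge0//.
rewrite -[X in _ <= X%:R]card_ord -sum1_card natr_sum; apply: ler_sum => i _.
by case/andP: (phi01 (h + k *+ i)).
Qed.

End box_average_theory.

Lemma ultra_compact_cvg (I : Type) (T : topologicalType) (K : set T)
    (F : set_system I) (f : I -> T) :
  UltraFilter F -> compact K -> (forall i, K (f i)) ->
  exists l : T, f @ F --> l.
Proof.
move=> UF cK fK; have PF := @ultra_proper _ _ UF.
have [|l [_ cl]] := cK (f @ F) _.
  by apply: (filterS (P := [set: I])) (@filterT _ F _) => i _; exact: fK.
exists l => V lV; rewrite /= nbhs_simpl /=.
have [//|FC] := in_ultra_setVsetC (f @^-1` V) UF.
by have [x []] := cl (~` V) V FC lV.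
Qed.

(** Additivity is stated in modular form, so that it also applies to overlapping sets; the triangle
    inequality of the pseudometric built later rests on this. *)
Record invariant_mean (R : realType) (H : zmodType) (mu : set H -> R) : Prop := {
  mean0 : mu set0 = 0;
  meanT : mu setT = 1;
  mean_ge0 : forall A, 0 <= mu A;
  meanUI : forall A B, mu (A `|` B) + mu (A `&` B) = mu A + mu B;
  mean_shift : forall A g, mu [set h | A (h + g)] = mu A }.

(** The mean of a set is the ultralimit of the box averages of its indicator as the finite set [F]
    and the side [n] grow. *)
Lemma invariant_mean_exists (R : realType) (H : zmodType) :
  exists mu : set H -> R, invariant_mean mu.
Proof.
pose FF : set_system (seq H * nat) := [set P | exists (F0 : seq H) n0,
  forall (F : seq H) n, {subset F0 <= F} -> (n0 <= n)%N -> P (F, n)].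
have FP : ProperFilter FF.
  split; first by case=> F0 [n0 /(_ F0 n0)]; apply.
  split.
  - by exists [::], 0%N.
  - move=> P Q [F1 [n1 P1]] [F2 [n2 P2]].
    exists (F1 ++ F2), (maxn n1 n2) => F n sF len; split.
      apply: P1 => [g gF|]; first by apply: sF; rewrite mem_cat gF.
      by rewrite (leq_trans _ len)// leq_maxl.
    apply: P2 => [g gF|]; first by apply: sF; rewrite mem_cat gF orbT.
    by rewrite (leq_trans _ len)// leq_maxr.
  - by move=> P Q PQ [F0 [n0 P0]]; exists F0, n0 => F n sF len; apply/PQ/P0.
have [U [UU FU]] := ultraFilterLemma FP.
have UP := @ultra_proper _ _ UU.
pose ind (A : set H) h : R := (h \in A)%:R.
have ind01 A h : 0 <= ind A h <= 1 by rewrite /ind; case: (h \in A); rewrite ?lexx ?ler01.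
pose a A (i : seq H * nat) := box_average i.2 i.1 (ind A).
have a01 A i : [set` `[0 : R, 1]] (a A i).
  rewrite /= in_itv/=; apply/andP; split.
    rewrite -[leLHS](box_average_cst i.2 i.1).
    by apply: le_box_average => h; case/andP: (ind01 A h).
  rewrite -[leRHS](box_average_cst i.2 i.1).
  by apply: le_box_average => h; case/andP: (ind01 A h).
have [mu /= muP] := choice (fun A => ultra_compact_cvg UU (@segment_compact _ 0 1) (a01 A)).
have {}muP : forall A, a A @ U --> (mu A : R) by [].
have uniq_lim (f : seq H * nat -> R) (l l' : R) : f @ U --> l -> f @ U --> l' -> l = l'.
  by move=> fl fl'; rewrite -(cvg_lim (@Rhausdorff R) fl) -(cvg_lim (@Rhausdorff R) fl').
exists mu; split.
- apply: (uniq_lim _ _ _ (muP _)); rewrite (_ : a set0 = fun=> 0).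
    exact: cvg_cst.
  apply/funext => i; rewrite -[RHS](box_average_cst i.2 i.1); congr box_average.
  by apply/funext => h; rewrite /ind in_set0.
- apply: (uniq_lim _ _ _ (muP _)); rewrite (_ : a setT = fun=> 1).
    exact: cvg_cst.
  apply/funext => i; rewrite -[RHS](box_average_cst i.2 i.1); congr box_average.
  by apply/funext => h; rewrite /ind in_setT.
- move=> A; apply: (cvgr_to_ge (muP A)).
  by apply: nearW => i; case/andP: (a01 A i).
- move=> A B; apply: (uniq_lim (a (A `|` B) + a (A `&` B))); first exact: cvgD.
  rewrite (_ : _ + _ = a A + a B); first exact: cvgD.
  apply/funext => i; rewrite /a /= !fctE -!box_averageD; congr box_average.
  apply/funext => h; rewrite /ind in_setU in_setI.
  by case: (h \in A); case: (h \in B); rewrite /= ?addr0 ?add0r.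
(* Once [F] contains [g], the shift error is at most [n.+1%:R^-1], eventually below [e]. The reverse
   inequality is this one for the translated set and [- g]. *)
have shift_le A g : mu [set h | A (h + g)] <= mu A.
  apply/ler_addgt0Pr => e e0.
  have [N Ne] := ltr_add_invr e0; rewrite add0r in Ne.
  rewrite -subr_ge0.
  apply: (@cvgr_to_ge _ U _ _ (a A + cst e - a [set h | A (h + g)])).
    by apply: cvgB => //; apply: cvgD => //; exact: cvg_cst.
  apply: FU; exists [:: g], N => F n gF Nn.
  rewrite /= !fctE subr_ge0 /a /=.
  rewrite (_ : ind _ = fun h => ind A (h + g)); last first.
    by apply/funext => h; rewrite /ind; congr (nat_of_bool _)%:R; rewrite !inE/=.
  have gF' : g \in F by apply: gF; rewrite inE.
  apply: (le_trans (box_average_shift n gF' (ind01 A))).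
  rewrite lerD2l (le_trans _ (ltW Ne))//.
  by rewrite lef_pV2 ?posrE ?ltr0n// ler_nat ltnS.
move=> A g; apply/eqP; rewrite eq_le shift_le/=.
have := shift_le [set h | A (h + g)] (- g).
by rewrite (_ : [set h | _ (h - g)] = A)//; apply/seteqP; split => h /=; rewrite subrK.
Qed.

Section invariant_mean_theory.
Context (R : realType) (H : zmodType) (mu : set H -> R).
Hypothesis mu_mean : invariant_mean mu.

Lemma le_mean A B : A `<=` B -> mu A <= mu B.
Proof.
move=> AB; have := meanUI mu_mean A (B `\` A).
rewrite setDUK// setDIK (mean0 mu_mean) addr0 => ->.
by rewrite lerDl (mean_ge0 mu_mean).
Qed.

Lemma mean_le1 A : mu A <= 1.
Proof. by rewrite -(meanT mu_mean); exact: le_mean. Qed.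

(** Translates of [S] indexed by [L] cover [H] and all have mean [mu S], so [1 <= size L * mu S] by
    subadditivity. *)
Lemma mean_syndetic_gt0 (S : set H) (L : seq H) :
  (forall h, exists2 l, l \in L & S (h + l)) -> 0 < mu S.
Proof.
move=> SL; suff bound K : mu [set h | exists2 l, l \in K & S (h + l)] <= (size K)%:R * mu S.
  have := bound L; rewrite (_ : [set h | _] = setT) ?(meanT mu_mean); last first.
    by apply/seteqP; split => // h _; exact: SL.
  rewrite lt_neqAle (mean_ge0 mu_mean) andbT; apply: contraTneq => <-.
  by rewrite mulr0 -ltNge ltr01.
elim: K => [|k K IH].
  rewrite (_ : [set h | _] = set0) ?(mean0 mu_mean) ?mul0r//.
  by apply/seteqP; split => // h [].
rewrite (_ : [set h | _] = [set h | S (h + k)] `|` [set h | exists2 l, l \in K & S (h + l)]).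
  have := meanUI mu_mean [set h | S (h + k)] [set h | exists2 l, l \in K & S (h + l)].
  rewrite (mean_shift mu_mean) /= mulrS mulrDl mul1r => ?.
  have := mean_ge0 mu_mean ([set h | S (h + k)] `&` [set h | exists2 l, l \in K & S (h + l)]).
  lra.
apply/seteqP; split => h /=.
  by case=> l; rewrite inE => /orP[/eqP->|lK] Shl; [left|right; exists l].
by case=> [Shk|[l lK Shl]]; [exists k|exists l] => //; rewrite inE ?eqxx ?lK ?orbT.
Qed.

End invariant_mean_theory.

(** * The equicontinuous factor of an invariant pseudometric *)

(** A pseudometric given by its balls, which avoids defining the distance as an infimum. *)
Record pseudoball (R : realType) (T : choiceType) := Pseudoball {
  pball :> T -> R -> T -> Prop;
  pball_center : forall x e, 0 < e -> pball x e x;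
  pball_sym : forall x y e, pball x e y -> pball y e x;
  pball_triangle : forall x y z e1 e2,
    pball x e1 y -> pball y e2 z -> pball x (e1 + e2) z }.

Section pseudoball_quotient.
Local Open Scope quotient_scope.
Context (R : realType) (T : choiceType) (b : pseudoball R T).

Definition inseparable (x y : T) : bool := `[< forall e, 0 < e -> b x e y >].

Lemma inseparable_refl : reflexive inseparable.
Proof. by move=> x; apply/asboolP => e; exact: pball_center. Qed.

Lemma inseparable_sym : symmetric inseparable.
Proof.
by move=> x y; apply/asboolP/asboolP => xy e /xy; exact: pball_sym.
Qed.

Lemma inseparable_trans : transitive inseparable.
Proof.
move=> y x z /asboolP xy /asboolP yz; apply/asboolP => e e0.
by rewrite (splitr e); apply: pball_triangle (xy _ _) (yz _ _); rewrite divr_gt0.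
Qed.

Definition inseparable_equiv :=
  EquivRel inseparable inseparable_refl inseparable_sym inseparable_trans.

Definition pball_quot : Type := {eq_quot inseparable_equiv}.

HB.instance Definition _ := Choice.on pball_quot.

Definition pball_proj (x : T) : pball_quot := \pi_({eq_quot inseparable_equiv}) x.
Definition pball_repr (w : pball_quot) : T := repr (w : {eq_quot inseparable_equiv}).

Lemma pball_reprK w : pball_proj (pball_repr w) = w.
Proof. exact: reprK. Qed.

Lemma pball_projP x y :
  pball_proj x = pball_proj y <-> forall e, 0 < e -> b x e y.
Proof.
split=> [/eqmodP/asboolP//|xy]; apply/eqmodP; exact/asboolP.
Qed.

Lemma pball_projK x e : 0 < e -> b (pball_repr (pball_proj x)) e x.
Proof. by move: e; apply/pball_projP; rewrite pball_reprK. Qed.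

(** Balls are read off at representatives: for a fixed radius, [b] is compatible with inseparability
    only up to an arbitrarily small enlargement. *)
Let qball w e w' := b (pball_repr w) e (pball_repr w').

Let pball_le x y e1 e2 : e1 <= e2 -> b x e1 y -> b x e2 y.
Proof.
rewrite le_eqVlt => /orP[/eqP->//|lt12 xy].
rewrite -(subrK e1 e2); apply: pball_triangle xy.
by apply: pball_center; rewrite subr_gt0.
Qed.

Let ent_filter : Filter (entourage_ qball).
Proof.
apply: filter_from_filter; first by exists 1 => /=.
move=> e1 e2 /= e10 e20; exists (Num.min e1 e2); first by rewrite /= lt_min e10.
by move=> [w w'] /= ww'; split; apply: pball_le ww'; rewrite ge_min lexx ?orbT.
Qed.

Let ent_diag A : entourage_ qball A -> diagonal `<=` A.
Proof.
move=> [e e0 sA] [w w'] /= ww'; apply: sA => /=; move: ww'.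
by rewrite /diagonal/= => ->; exact: pball_center.
Qed.

Let ent_inv A : entourage_ qball A -> entourage_ qball A^-1%relation.
Proof. by move=> [e e0 sA]; exists e => // ww' /pball_sym; exact: (sA (_, _)). Qed.

Let ent_split A : entourage_ qball A ->
  exists2 B, entourage_ qball B & (B \; B)%relation `<=` A.
Proof.
move=> [e e0 sA]; exists [set ww' | qball ww'.1 (e / 2) ww'.2].
  by exists (e / 2) => //=; rewrite divr_gt0.
move=> ww' [z wz zw']; apply: sA => /=; rewrite (splitr e).
exact: pball_triangle zw'.
Qed.

HB.instance Definition _ :=
  isUniform.Build pball_quot ent_filter ent_diag ent_inv ent_split.

Lemma entourage_pball_quotP (A : set (pball_quot * pball_quot)) : entourage A <->
  exists2 e, 0 < e & forall w w', b (pball_repr w) e (pball_repr w') -> A (w, w').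
Proof.
split=> [[e e0 sA]|[e e0 sA]]; exists e => //; first by move=> w w' /(sA (w, w')).
by case=> w w' /= /sA.
Qed.

Lemma nbhs_pball_quotP (w : pball_quot) (A : set pball_quot) : nbhs w A <->
  exists2 e, 0 < e & forall w', b (pball_repr w) e (pball_repr w') -> A w'.
Proof.
rewrite -nbhs_entourageE; split=> [[E /entourage_pball_quotP[e e0 sE] sA]|[e e0 sA]].
  by exists e => // w' /sE ww'; apply/sA/mem_set.
exists [set ww' | qball ww'.1 e ww'.2]; first by apply/entourage_pball_quotP; exists e.
by move=> w' /set_mem /sA.
Qed.

Lemma pball_quot_hausdorff : hausdorff_space pball_quot.
Proof.
move=> w w' cl; rewrite -(pball_reprK w) -(pball_reprK w'); apply/pball_projP => e e0.
have e20 : 0 < e / 2 by rewrite divr_gt0.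
have [//|//|z [wz w'z]] := cl [set z | qball w (e / 2) z] [set z | qball w' (e / 2) z].
- by apply/nbhs_pball_quotP; exists (e / 2).
- by apply/nbhs_pball_quotP; exists (e / 2).
by rewrite (splitr e); apply: pball_triangle wz _; exact: pball_sym.
Qed.

End pseudoball_quotient.

Lemma pball_proj_continuous (R : realType) (X : topologicalType)
    (b : pseudoball R X) : (forall x e, 0 < e -> nbhs x (b x e)) ->
  continuous (@pball_proj R X b).
Proof.
move=> bnbhs x A /nbhs_pball_quotP[e e0 sA].
have e30 : 0 < e / 3 by rewrite divr_gt0.
apply: filterS (bnbhs x _ e30) => y xy; apply: sA.
have -> : e = e / 3 + (e / 3 + e / 3) by lra.
apply: pball_triangle (pball_projK b x e30) _; apply: pball_triangle xy _.
exact/pball_sym/pball_projK.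
Qed.

Lemma pball_quot_factor (R : realType) (G : topologicalZmodType)
    (X : topologicalType) (act : G -> X -> X) (b : pseudoball R X) :
  Gsystem act -> (forall x e, 0 < e -> nbhs x (b x e)) ->
  (forall g x y e, b x e y -> b (act g x) e (act g y)) ->
  let actW g w := pball_proj b (act g (pball_repr w)) in
  [/\ Gsystem actW, equicontinuous_sys actW &
      extension act actW (pball_proj b)].
Proof.
move=> [cX hX ctX act0 actD] bnbhs binv actW.
have projE g x : pball_proj b (act g x) = actW g (pball_proj b x).
  by apply/pball_projP => e e0; apply/binv/pball_sym/pball_projK.
have proj_ct := pball_proj_continuous bnbhs.
have actWD g h w : actW (g + h) w = actW g (actW h w).
  by rewrite -projE -actD.
have repr_act g x y e d : 0 < d -> b x e y ->
    b (pball_repr (actW g (pball_proj b x))) (d + (e + d)) (pball_repr (actW g (pball_proj b y))).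
  move=> d0 xy; rewrite -!projE; apply: pball_triangle (pball_projK _ _ d0) _.
  by apply: pball_triangle (binv g _ _ _ xy) _; exact/pball_sym/pball_projK.
split.
- split.
  + rewrite (_ : setT = pball_proj b @` setT).
      by apply: continuous_compact => //; exact/continuous_subspaceT.
    by apply/seteqP; split => // w _; exists (pball_repr w) => //; exact: pball_reprK.
  + exact: pball_quot_hausdorff.
  + move=> [g w] A /nbhs_pball_quotP[e e0 sA].
    have e80 : 0 < e / 8 by rewrite divr_gt0.
    have gx : {for g, continuous (fun h => act h (pball_repr w))}.
      move=> B gB; have := ctX (g, pball_repr w) B gB.
      rewrite /nbhs/= => -[[P Q] [/= gP wQ] PQ].
      by apply: filterS gP => h Ph; apply: (PQ (h, _)); split => //=; exact: nbhs_singleton.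
    exists ([set h | b (act g (pball_repr w)) (e / 8) (act h (pball_repr w))],
            [set w' | b (pball_repr w) (e / 8) (pball_repr w')]); first split => /=.
      * exact: gx (bnbhs _ _ e80).
      * by apply/nbhs_pball_quotP; exists (e / 8).
    move=> [h w'] [/= gh ww']; apply: sA.
    have := repr_act h _ _ _ _ e80 ww'; rewrite !pball_reprK => hww'.
    (* Three eighths replace [g] by [h] at [w], three replace [w] by [w'] under [h], and two are
       slack. *)
    have -> : e = (e / 8 + (e / 8 + e / 8)) + ((e / 8 + (e / 8 + e / 8)) + (e / 8 + e / 8)) by lra.
    apply: pball_triangle (pball_triangle hww' _).
      apply: pball_triangle (pball_projK _ _ e80) (pball_triangle gh _).
      exact/pball_sym/pball_projK.
    by apply: pball_center; rewrite addr_gt0.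
  + by move=> w; rewrite /actW act0 pball_reprK.
  + exact: actWD.
- move=> E /entourage_pball_quotP[e e0 sE].
  have e30 : 0 < e / 3 by rewrite divr_gt0.
  exists [set ww' | b (pball_repr ww'.1) (e / 3) (pball_repr ww'.2)].
    by apply/entourage_pball_quotP; exists (e / 3).
  move=> g w w' /= ww'; apply: sE.
  have := repr_act g _ _ _ _ e30 ww'; rewrite !pball_reprK.
  by have -> : e / 3 + (e / 3 + e / 3) = e by lra.
- split => //; by move=> w; exists (pball_repr w); exact: pball_reprK.
Qed.

(** * Recurrence in minimal systems *)

Section Gsystem_basics.
Context (G : topologicalZmodType) (X : topologicalType) (act : G -> X -> X).
Hypothesis sysX : Gsystem act.

Lemma act_continuous g : continuous (act g).
Proof.
have [_ _ ct _ _] := sysX => x B gB; have := ct (g, x) B gB.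
rewrite /nbhs/= => -[[P Q] [/= gP xQ] PQ].
by apply: filterS xQ => y Qy; apply: (PQ (g, y)); split => //=; exact: nbhs_singleton.
Qed.

Lemma actK g x : act (- g) (act g x) = x.
Proof. by have [_ _ _ act0 actD] := sysX; rewrite -actD addNr act0. Qed.

Lemma actNK g x : act g (act (- g) x) = x.
Proof. by have [_ _ _ act0 actD] := sysX; rewrite -actD subrr act0. Qed.

Lemma Gsystem_regular (x : X) (V : set X) : nbhs x V ->
  exists2 C, nbhs x C /\ closed C & C `<=` V.
Proof.
have [cX hX _ _ _] := sysX => xV.
have [C xC CV] := compact_regular hX cX (@filterT _ (nbhs x) _) xV.
exists (closure C) => //; split; last exact: closed_closure.
apply: filterS xC; exact: subset_closure.
Qed.

Lemma open_act_preimage g (V : set X) : open V -> open (act g @^-1` V).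
Proof. by move=> oV; apply: open_comp => // x _; exact: act_continuous. Qed.

Hypothesis minX : minimal act.

Lemma minimal_hit (x y : X) (V : set X) : nbhs x V -> exists g, V (act g y).
Proof.
move=> xV; have : closure (Defs.orbit act y) x by rewrite minX.
by move=> /(_ V xV) [_ [[g _ <-]]]; exists g.
Qed.

(** Every orbit enters [V], so the preimages of [V] cover [X], and compactness retains finitely many
    of them. *)
Lemma minimal_syndetic (V : set X) : open V -> V !=set0 ->
  exists L : seq G, forall x, exists2 l, l \in L & V (act l x).
Proof.
move=> oV [v Vv]; have [cX _ _ _ _] := sysX.
suff [L LP] : exists L : seq G, forall x, [set: X] x -> exists2 l, l \in L & V (act l x).
  by exists L => x; exact: LP.
pose Q (K : set X) := exists L : seq G, forall x, K x -> exists2 l, l \in L & V (act l x).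
apply: (compact_ind (Q := Q) cX).
- by exists [::].
- by move=> A B AB [L LP]; exists L => x /AB /LP.
- move=> A B [L1 P1] [L2 P2]; exists (L1 ++ L2) => x [/P1|/P2] [l lL Vl];
  by exists l => //; rewrite mem_cat lL ?orbT.
- move=> p _; have [g Vg] := minimal_hit p (open_nbhs_nbhs (conj oV Vv)).
  exists (act g @^-1` V); first exact/open_nbhs_nbhs/(conj (open_act_preimage _ oV)).
  by exists [:: g] => x Vx; exists g => //; rewrite inE.
Qed.

End Gsystem_basics.

(* McMahon's argument: a set [M] in [X * H] invariant under [G] has sections of
   constant inner mean by minimality, so the mean of the symmetric difference of
   two sections is an invariant continuous pseudometric on [X]. *)
Lemma equicont_related_return (G : topologicalZmodType) (X Y : topologicalType)
    (actX : G -> X -> X) (actY : G -> Y -> Y) (pi : X -> Y) (H : zmodType)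
    (delta : G -> H) (S : set H) (L : seq H) (U : set X) (a a' : X) :
  Gsystem actX -> minimal actX -> equicont_factors_through actX actY pi ->
  {morph delta : g h / g + h} -> (forall h, exists2 l, l \in L & S (h + l)) ->
  pi a = pi a' -> open U -> U a' ->
  exists2 s, U (actX s a) & exists2 h, S h & S (h + delta s).
Proof.
move=> sysX minX factX deltaD SL paa' oU Ua'; apply: contrapT => no_return.
have [_ _ _ act0 actD] := sysX.
have [mu mu_mean] := invariant_mean_exists Rdefinitions.R H.
(* By [no_return] the section [M a] misses [S], whereas [S] lies in [M y] for every [y] in [U], with
   [s = 0]. The two facts will collide at [a] and [a']. *)
pose M x h := exists2 s, U (actX s x) & S (h + delta s).
pose inner (x : X) (C : set H) := exists2 W, nbhs x W & forall y h, W y -> C h -> M y h.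
have innerS x C D : D `<=` C -> inner x C -> inner x D.
  by move=> DC [W xW WC]; exists W => // y h Wy /DC; exact: WC.
have innerU x C D : inner x C -> inner x D -> inner x (C `|` D).
  move=> [W xW WC] [W' xW' WD]; exists (W `&` W'); first exact: filterI.
  by move=> y h [Wy W'y] [/(WC _ _ Wy)|/(WD _ _ W'y)].
have inner_near x C : inner x C -> \forall y \near x, inner y C.
  case=> W /nbhs_interior xW WC; apply: filterS xW => y yW.
  by exists W.
have inner_act g x C : inner (actX g x) C -> inner x [set h | C (h + delta g)].
  case=> W xW WC; exists (actX g @^-1` W); first exact: act_continuous.
  move=> y h Wy Ch; have [s Us Ss] := WC _ _ Wy Ch; exists (s + g); first by rewrite actD.
  by rewrite deltaD addrA addrAC.
(* Some translate of [y] falls where [C] is still inner; pulling back shifts [C] without changing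
   its mean. Hence the supremum [c] below is the same at all points. *)
have inner_transfer x y C : inner x C -> exists2 D, inner y D & mu D = mu C.
  move=> /inner_near xC; have [g /inner_act gC] := minimal_hit minX y xC.
  by eexists; [exact: gC|exact: mean_shift].
pose c := sup [set mu C | C in inner a].
have supa : has_sup [set mu C | C in inner a].
  split; first by exists (mu set0); exists set0 => //; exists setT => //; exact: filterT.
  by exists 1 => _ [C _ <-]; exact: mean_le1.
have inner_le x C : inner x C -> mu C <= c.
  move=> /(inner_transfer _ a) [D aD <-].
  by apply: sup_ubound; [exact: (proj2 supa)|exists D].
have inner_gt x e : 0 < e -> exists2 C, inner x C & c - e < mu C.
  move=> /sup_adherent /(_ supa) [_ [C aC <-] lt].
  by have [D xD DC] := inner_transfer _ x _ aC; exists D; rewrite ?DC.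
(* Two points are close when a single set of nearly maximal mean is inner at both. *)
pose ball x e y := exists C, [/\ inner x C, inner y C & c - e < mu C].
have ball_center x e : 0 < e -> ball x e x.
  by move=> /(inner_gt x) [C xC lt]; exists C.
have ball_sym x y e : ball x e y -> ball y e x by case=> C []; exists C.
have ball_triangle x y z e1 e2 : ball x e1 y -> ball y e2 z -> ball x (e1 + e2) z.
  move=> [C [xC yC ltC]] [D [yD zD ltD]]; exists (C `&` D); split.
  - by apply: innerS xC; exact: subIsetl.
  - by apply: innerS zD; exact: subIsetr.
  (* Both sets are inner at [y], so their union has mean at most [c], which bounds the mean of the
     intersection from below. *)
  - have := meanUI mu_mean C D; have := inner_le _ _ (innerU _ _ _ yC yD); lra.
pose b := Pseudoball ball_center ball_sym ball_triangle.
have bnbhs x e : 0 < e -> nbhs x (b x e).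
  move=> /(inner_gt x) [C xC lt].
  by apply: filterS (inner_near _ _ xC) => y yC; exists C.
have binv g x y e : b x e y -> b (actX g x) e (actX g y).
  case=> C [xC yC lt]; exists [set h | C (h + delta (- g))].
  by split; rewrite ?(mean_shift mu_mean)//; apply: inner_act; rewrite (actK sysX).
have [sysW eqW extW] := pball_quot_factor sysX bnbhs binv.
have [theta' [_ thetaE]] := factX _ _ _ sysW eqW extW.
have : pball_proj b a = pball_proj b a' by rewrite thetaE /= paa'.
(* At radius [mu S] there is a common inner set [C] of mean above [c - mu S]. It is disjoint from
   [S], and both are inner at [a'], so their union has mean above [c]. *)
move=> /pball_projP/(_ (mu S)) [].
  exact: mean_syndetic_gt0 SL.
move=> C [[W /nbhs_singleton Wa WC] a'C ltC].
have CS : C `&` S = set0.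
  rewrite -subset0 => h [Ch Sh]; have [s Us Ss] := WC _ _ Wa Ch.
  by apply: no_return; exists s => //; exists h.
have a'S : inner a' S.
  exists U; first exact: open_nbhs_nbhs.
  move=> y h Uy Sh; exists 0; first by rewrite act0.
  suff -> : delta 0 = 0 by rewrite addr0.
  by apply: (@addrI _ (delta 0)); rewrite -deltaD !addr0.
have := inner_le _ _ (innerU _ _ _ a'C a'S).
have := meanUI mu_mean C S; rewrite CS (mean0 mu_mean).
lra.
Qed.

(** * Tame extensions *)

Lemma interiorU_closed_eq0 (T : topologicalType) (A B : set T) :
  closed A -> A° = set0 -> B° = set0 -> (A `|` B)° = set0.
Proof.
move=> cA A0 B0; rewrite -subset0 => x xAB.
have BA : (A `|` B)° `&` ~` A `<=` B° .
  rewrite -open_subsetE; first by move=> y [/interior_subset [Ay []|//]].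
  by apply: openI; [exact: open_interior|exact: closed_openC].
have : (A `|` B)° `<=` A°.
  rewrite -open_subsetE; last exact: open_interior.
  move=> y yAB; apply: contrapT => nAy.
  by have : B° y by [exact: BA]; rewrite B0.
by move=> /(_ x xAB); rewrite A0.
Qed.

Section extensions.
Context (G : topologicalZmodType) (X Y : topologicalType).
Context (actX : G -> X -> X) (actY : G -> Y -> Y) (pi : X -> Y).
Hypotheses (sysX : Gsystem actX) (sysY : Gsystem actY).
Hypotheses (minX : minimal actX) (minY : minimal actY).
Hypothesis extpi : extension actX actY pi.

Lemma extension_closed_image (C : set X) : closed C -> closed (pi @` C).
Proof.
have [cX _ _ _ _] := sysX; have [_ hY _ _ _] := sysY; have [pi_ct _ _] := extpi.
move=> clC; apply: compact_closed => //; apply: continuous_compact.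
  exact: continuous_subspaceT.
exact: subclosed_compact cX _.
Qed.

Lemma extension_image_interior (V : set X) : open V -> V !=set0 ->
  (pi @` V)° !=set0.
Proof.
move=> oV [v Vv]; have [_ pi_surj pi_act] := extpi.
have [C [vC clC] CV] := Gsystem_regular sysX (open_nbhs_nbhs (conj oV Vv)).
suff [y yC] : (pi @` C)° !=set0.
  by exists y; move: yC; apply: interiorS; exact: image_subset.
apply/set0P/eqP => C0.
have [|L LP] := minimal_syndetic sysX minX (@open_interior _ C); first by exists v.
pose D (K : seq G) := [set y | exists2 l, l \in K & (pi @` C) (actY l y)].
have DP K : closed (D K) /\ (D K)° = set0.
  elim: K => [|k K [clK K0]].
    by rewrite (_ : D [::] = set0) ?interior0 ; [split => //; exact: closed0|apply/seteqP; split => // y []].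
  have -> : D (k :: K) = (actY k @^-1` (pi @` C)) `|` D K.
    apply/seteqP; split => y /=.
      by case=> l; rewrite inE => /orP[/eqP->|lK] Cl; [left|right; exists l].
    by case=> [Ck|[l lK Cl]]; [exists k|exists l] => //; rewrite inE ?eqxx ?lK ?orbT.
  have clk : closed (actY k @^-1` (pi @` C)).
    by apply: closed_comp (extension_closed_image clC) => y _; exact: act_continuous.
  split; first exact: closedU.
  apply: interiorU_closed_eq0 => //; rewrite -subset0 => y yk.
  have : actY (- k) @^-1` (actY k @^-1` (pi @` C))° `<=` (pi @` C)°.
    rewrite -open_subsetE; last exact/(open_act_preimage sysY)/open_interior.
    by move=> z /interior_subset /=; rewrite (actNK sysY).
  by rewrite C0 => /(_ (actY k y)) /=; rewrite (actK sysY) => /(_ yk).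
have [_] := DP L; rewrite (_ : D L = setT) ?interiorT.
  by move=> /seteqP[/(_ (pi v) I)].
apply/seteqP; split => // y _; have [x <-] := pi_surj y.
have [l lL /interior_subset Cl] := LP x.
by exists l => //; rewrite -pi_act; exists (actX l x).
Qed.

(** * From high proximality to proximality and condition (3) *)

Lemma highly_proximal_proximal : highly_proximal actX pi -> proximal_ext actX pi.
Proof.
move=> hp x1 x2 px; exists x1 => V [[P Q] /= [x1P x1Q] PQ].
have [||s sP] := hp (P `&` Q)° _ _ (pi x1); first exact: open_interior.
  by exists x1; apply: filterI.
have [u1 /interior_subset PQu1 su1] := sP x1 erefl.
have [u2 /interior_subset PQu2 su2] := sP x2 (esym px).
exists (u1, u2); split; last by apply: PQ; split => /=; [case: PQu1|case: PQu2].
by exists (- s) => //; rewrite -su1 -su2 !(actK sysX).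
Qed.

(** Proximality makes some translate of the pair [D]-close in [W]; equicontinuity keeps it [E]-close
    when the translation is undone. *)
Lemma equicontinuous_proximal (W : uniformType) (actW : G -> W -> W)
    (theta : X -> W) (x1 x2 : X) :
  Gsystem actW -> equicontinuous_sys actW -> extension actX actW theta ->
  proximal_pair actX x1 x2 -> theta x1 = theta x2.
Proof.
move=> sysW eqW [th_ct _ th_act] [x clx]; have [_ hW _ _ _] := sysW.
apply: hW => A B x1A x2B; exists (theta x2); split; last exact: nbhs_singleton.
move: x1A; rewrite -nbhs_entourageE => -[E entE sA]; apply/sA/mem_set.
have [D entD DE] := eqW _ entE.
have sD := entourage_split_ent entD.
pose V := theta @^-1` xsection (split_ent D) (theta x).
pose V' := theta @^-1` xsection ((split_ent D)^-1)%relation (theta x).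
have [|_ [[g _ <-] [/= gx1 gx2]]] := clx (V' `*` V).
  exists (V', V) => //; split => /=.
    by apply: th_ct; exact: nbhs_entourage (entourage_inv sD).
  by apply: th_ct; exact: nbhs_entourage sD.
move: gx1 gx2 => /set_mem gx1 /set_mem gx2.
rewrite -(actK sysW g (theta x1)) -(actK sysW g (theta x2)) -!(th_act g).
by apply: DE; apply: (entourage_split (theta x)).
Qed.

Lemma proximal_equicont_factors_through :
  proximal_ext actX pi -> equicont_factors_through actX actY pi.
Proof.
move=> prox W actW theta sysW eqW extW; have [pi_ct pi_surj pi_act] := extpi.
have [sec secK] := choice pi_surj.
have [th_ct th_surj th_act] := extW.
have thetaE x : theta x = theta (sec (pi x)).
  by apply: (equicontinuous_proximal sysW eqW extW); apply: prox; rewrite secK.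
exists (theta \o sec); split; last exact/funext.
split=> [|w|g y] /=.
- apply/continuousP => U oU.
  (* Continuity comes from [pi] being a closed map, although [sec] is an arbitrary section. *)
  have -> : (theta \o sec) @^-1` U = ~` (pi @` (~` (theta @^-1` U))).
    apply/seteqP; split => [y Uy [x nUx pxy]|y nUy].
      by apply: nUx; rewrite /= thetaE pxy.
    by apply: contrapT => nU; apply: nUy; exists (sec y).
  apply: closed_openC; apply: extension_closed_image; apply: open_closedC.
  by move/continuousP: th_ct; apply.
- by have [x <-] := th_surj w; exists (pi x); rewrite -thetaE.
- by rewrite -th_act [RHS]thetaE pi_act secK.
Qed.

(** * Simultaneous returns and independence sets under condition (3) *)

Hypothesis factX : equicont_factors_through actX actY pi.

(** McMahon's argument in the power [H] of [G] indexed by [I], with [delta] diagonal and [S] the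
    tuples that send [a] into every [E i] coordinatewise: a return of [S] to itself along [delta s]
    is a return of each [E i] along [s]. *)
Lemma family_return_one (I : finType) (E : I -> set X) (j : I) (a a' : X) :
  (forall i, open (E i) /\ E i !=set0) -> E j a' -> pi a = pi a' ->
  exists2 s, E j (actX s a) &
    forall i, exists2 x, E i x & E i (actX s x).
Proof.
move=> oE Ea' paa'; have [_ _ _ act0 actD] := sysX.
have [f fP] := choice (fun i => minimal_syndetic sysX minX (oE i).1 (oE i).2).
pose L := flatten [seq f i | i : I].
pose H := {ffun I -> G}.
pose S := [set h : H | forall i, E i (actX (h i) a)].
(* All tuples with entries in the pooled list [L]; correcting each coordinate separately shows that
   [S] is syndetic. *)
pose LH : seq H := [seq [ffun i => nth 0 L (t i)] | t : {ffun I -> 'I_(size L)}].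
have SL h : exists2 l, l \in LH & S (h + l).
  have /choice[t tP] : forall i, exists k : 'I_(size L), E i (actX (nth 0 L k) (actX (h i) a)).
    move=> i; have [l lf El] := fP i (actX (h i) a).
    have lL : l \in L by apply/flattenP; exists (f i) => //; exact/map_f/mem_enum.
    by exists (Ordinal (etrans (index_mem l L) lL)); rewrite /= nth_index.
  exists [ffun i => nth 0 L ([ffun i => t i] i)]; first by apply/map_f; rewrite mem_enum.
  by move=> i; rewrite !ffunE addrC actD.
pose delta (g : G) : H := [ffun=> g].
have deltaD : {morph delta : g h / g + h} by move=> g h; apply/ffunP => i; rewrite !ffunE.
have [s Es [h Sh Shs]] :=
  equicont_related_return sysX minX factX deltaD SL paa' (oE j).1 Ea'.
exists s => // i; exists (actX (h i) a) => //.
by have := Shs i; rewrite !ffunE addrC actD.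
Qed.

Lemma family_return (I : finType) (A E : I -> set X) :
  (forall i, open (A i)) -> (forall i, open (E i) /\ E i !=set0) ->
  (forall i, E i `<=` pi @^-1` (pi @` A i)) ->
  exists s, forall i, exists2 x, A i x & E i (actX s x).
Proof.
move=> oA oE EA; have [_ _ _ act0 actD] := sysX.
(* The indices in [r] have been treated: there [F i] already lies in [A i], elsewhere still in
   [E i]. Treating [j] moves a point of [A j] into [F j] while every [F i] returns to itself. *)
suff /(_ (enum I)) [s [F FP]] : forall r : seq I, exists s (F : I -> set X), forall i,
    [/\ open (F i), F i !=set0, F i `<=` (if i \in r then A i else E i) &
        F i `<=` actX s @^-1` E i].
  exists s => i; have [_ [x Fx] FA FE] := FP i.
  by exists x; [have := FA x Fx; rewrite mem_enum|exact: FE].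
elim=> [|j r [s [F FP]]].
  exists 0, E => i; split=> //; [exact: (oE i).1|exact: (oE i).2|].
  by move=> x; rewrite /= act0.
have [jr|jr] := boolP (j \in r).
  exists s, F => i; rewrite inE; case: eqP => [->|_] /=; last exact: FP.
  by have := FP j; rewrite jr.
have [_ [a' Fa'] FjE _] := FP j; move: FjE; rewrite (negbTE jr) => FjE.
have [a Aa paa'] := EA _ _ (FjE _ Fa').
have oF i : open (F i) /\ F i !=set0 by have [] := FP i.
have [s' s'a s'F] := family_return_one oF Fa' paa'.
exists (s + s'), (fun i => (if i == j then A j else F i) `&` actX s' @^-1` F i) => i.
have [oFi Fi0 FiA FiE] := FP i; split.
- by apply: openI; [case: eqP|exact: open_act_preimage].
- have [->|_] := eqVneq i j; first by exists a.
  by have [x Fx Fs'x] := s'F i; exists x.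
- by rewrite inE; case: eqP => [->|_] /= x [] // /FiA.
- by move=> x [_ /FiE]; rewrite /= actD.
Qed.

Lemma fibre_pair_IT2 (x1 x2 : X) : x1 <> x2 ->
  (forall U1 U2, open U1 -> open U2 -> U1 x1 -> U2 x2 ->
     (pi @` U1 `&` pi @` U2)° !=set0) ->
  IT2 actX x1 x2.
Proof.
move=> x12 fib U V x1U x2V.
have [_ hX _ _ _] := sysX; have [pi_ct pi_surj _] := extpi.
have [U1 [U2 [[oU1 U1x1 sU1] [oU2 U2x2 sU2] U12]]] : exists U1 U2,
    [/\ [/\ open U1, U1 x1 & U1 `<=` U], [/\ open U2, U2 x2 & U2 `<=` V]
      & U1 `&` U2 = set0].
  move: hX; rewrite open_hausdorff => /(_ x1 x2) [|[P Q] /=]; first exact/eqP.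
  rewrite !inE => -[Px1 Qx2] [oP oQ PQ].
  exists (P `&` U°), (Q `&` V°); split; last 1 first.
  - by rewrite -subset0 -PQ => x [[Px _] [Qx _]].
  - by split; [exact: openI oP (@open_interior _ _)|split|move=> x [_ /interior_subset]].
  - by split; [exact: openI oQ (@open_interior _ _)|split|move=> x [_ /interior_subset]].
pose B j := if j then U1 else U2.
have oB j : open (B j) by case: j.
pose W := (pi @` U1 `&` pi @` U2)°.
have WB j : W `<=` pi @` B j by move=> y /interior_subset []; case: j.
(* The cells are kept over [W], so each fibre that meets a cell also meets both [U1] and [U2]. *)
pose Z (l : seq G) (sigma : G -> bool) :=
  [set x | W (pi x) /\ forall s, s \in l -> B (sigma s) (actX s x)].
have ZS s l sigma : Z (s :: l) sigma = Z l sigma `&` actX s @^-1` B (sigma s).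
  apply/seteqP; split=> x /=.
    by case=> Wx xl; split; [split=> // t tl|]; apply: xl; rewrite inE ?eqxx ?tl ?orbT.
  by case=> -[Wx xl] xs; split => // t; rewrite inE => /orP[/eqP->//|]; exact: xl.
have oZ l sigma : open (Z l sigma).
  elim: l => [|s l IH]; last by rewrite ZS; apply: openI => //; exact: open_act_preimage.
  rewrite (_ : Z _ _ = pi @^-1` W); last by apply/seteqP; split => x /=; [case|].
  by apply: open_comp (@open_interior _ _) => x _; exact: pi_ct.
pose P l := forall sigma, Z l sigma !=set0.
have step l : P l -> exists2 s, s \notin l & P (s :: l).
  (* A cell depends only on the values of [sigma] on [l], so tuples give a finite index type; the
     default [false] only concerns points outside [l]. *)
  move=> Pl; pose sig (t : (size l).-tuple bool) s := nth false t (index s l).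
  pose V' t := (pi @` Z l (sig t))°.
  (* Pairing each cell with both choices [j] makes one [s] split every cell into two nonempty
     ones. *)
  have [||| s sP] := @family_return ((size l).-tuple bool * bool)%type
      (fun tj => Z l (sig tj.1)) (fun tj => B tj.2 `&` pi @^-1` V' tj.1).
  - by move=> tj; exact: oZ.
  - move=> [t j] /=; split.
      by apply: openI => //; apply: open_comp (@open_interior _ _) => x _; exact: pi_ct.
    have [y yV] := extension_image_interior (oZ l (sig t)) (Pl (sig t)).
    have [z [Wz _] zy] := interior_subset yV.
    by have [u Bu uy] := WB j _ Wz; exists u; split => //=; rewrite uy zy.
  - by move=> [t j] x /= [_ /interior_subset].
  exists s.
    (* Were [s] in [l], the all-true cell would put [actX s x] in [U1], and the choice [false] would
       put it in [U2]. *)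
    apply/negP => sl.
    have [x /= [_ /(_ _ sl)]] := sP ([tuple of nseq (size l) true], false).
    rewrite /sig /= nth_nseq index_mem sl /= => U1x [U2x _].
    by have : (U1 `&` U2) (actX s x) by []; rewrite U12.
  move=> sigma; have [x /= [Wx xl] [Bx _]] := sP (map_tuple sigma (in_tuple l), sigma s).
  exists x; rewrite ZS; split => //; split => // t tl.
  by have := xl t tl; rewrite /sig /= (nth_map 0) ?index_mem// nth_index.
have P0 : P [::].
  move=> sigma; have [y Wy] := fib _ _ oU1 oU2 U1x1 U2x2.
  by have [x xy] := pi_surj y; exists x; split => //; rewrite xy.
have /choice[next nextP] : forall l : {l | P l}, exists l' : {l | P l},
    exists2 s, s \notin sval l & sval l' = s :: sval l.
  by move=> [l Pl]; have [s sl Psl] := step l Pl; exists (exist _ _ Psl), s.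
pose lst n := sval (iter n next (exist _ _ P0)).
have lstS n : exists2 s, s \notin lst n & lst n.+1 = s :: lst n by exact: nextP.
have lst_uniq n : uniq (lst n) /\ size (lst n) = n.
  elim: n => [//|n [un sn]]; have [s sl ->] := lstS n.
  by rewrite /= sl un sn.
have lst_sub n m : (n <= m)%N -> {subset lst n <= lst m}.
  move=> /subnK <-; elim: (m - n)%N => [//|k IH] s /IH sk; rewrite addSn.
  by have [t _ ->] := lstS (k + n)%N; rewrite inE sk orbT.
exists [set s | exists n, s \in lst n]; split.
  move=> /finite_seqP[r rE]; have [un sn] := lst_uniq (size r).+1.
  suff : (size (lst (size r).+1) <= size r)%N by rewrite sn ltnn.
  apply: uniq_leq_size => // s sl.
  by have : [set` r] s by rewrite -rE; exists (size r).+1.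
(* The lists increase, so a finite [I] lies in a single [lst n], whose cell for [sigma] is
   nonempty. *)
move=> I sigma /finite_seqP[r ->] _ rJ.
have [n rn] : exists n, {subset r <= lst n}.
  elim: r rJ => [|s r IH] rJ; first by exists 0%N.
  have [|n rn] := IH; first by move=> t /= tr; apply: rJ; rewrite /= inE tr orbT.
  have [m sm] : exists m, s \in lst m by apply: rJ; rewrite /= inE eqxx.
  exists (maxn n m) => t; rewrite inE => /orP[/eqP->|/rn].
    by apply: lst_sub sm; exact: leq_maxr.
  exact/lst_sub/leq_maxl.
have [x [_ xl]] : Z (lst n) sigma !=set0 by exact: (svalP (iter n next _)).
exists x => s /= /rn /xl; rewrite /B; case: (sigma s); [exact: sU1|exact: sU2].
Qed.

Lemma tame_highly_proximal : tame actX pi -> highly_proximal actX pi.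
Proof.
move=> tamepi U oU [u Uu] z; have [cX _ _ _ _] := sysX.
have [_ hY _ _ _] := sysY; have [pi_ct pi_surj pi_act] := extpi.
have [C [uC clC] CU] := Gsystem_regular sysX (open_nbhs_nbhs (conj oU Uu)).
(* This property of sets of pairs passes to subsets and finite unions, so compactness reduces it to
   small neighbourhoods of a pair. *)
pose Q (K : set (X * X)) := exists D : set Y, [/\ closed D, D° = set0 &
  forall a b, K (a, b) -> pi a = pi b -> D (pi a)].
have [D [clD D0 DP]] : Q (C `*` ~` U).
  apply: compact_ind.
  - by apply: compact_setX; apply: subclosed_compact cX _ => //; exact: open_closedC.
  - by exists set0; split => //; [exact: closed0|exact: interior0].
  - by move=> K K' KK' [D [clD D0 DP]]; exists D; split => // a b /KK'; exact: DP.
  - move=> K K' [D [clD D0 DP]] [D' [clD' D'0 DP']]; exists (D `|` D'); split.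
    + exact: closedU.
    + exact: interiorU_closed_eq0.
    + by move=> a b [/DP|/DP'] + /[dup] pab => /(_ pab); [left|right].
  move=> [a b] [/= Ca nUb]; have [pab|pab] := pselect (pi a = pi b); last first.
    move: hY; rewrite open_hausdorff => /(_ (pi a) (pi b)) [|[V V'] /=]; first exact/eqP.
    rewrite !inE => -[Va V'b] [oV oV' VV'].
    exists ((pi @^-1` V) `*` (pi @^-1` V')).
      exists (pi @^-1` V, pi @^-1` V') => //=; split; apply: pi_ct;
      exact: open_nbhs_nbhs.
    exists set0; split; [exact: closed0|exact: interior0|].
    move=> c d [Vc V'd] pcd; have : (V `&` V') (pi c) by split => //; rewrite pcd.
    by rewrite VV'.
  (* A pair in one fibre with [a] in [C] and [b] outside [U] is off the diagonal, so tameness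
     excludes it from [IT2]. *)
  have [U1 [U2 [oU1 oU2 U1a U2b U120]]] : exists U1 U2,
      [/\ open U1, open U2, U1 a, U2 b & (pi @` U1 `&` pi @` U2)° = set0].
    apply: contrapT => nU; suff ab : a = b by apply: nUb; rewrite -ab; exact: CU.
    apply: tamepi => //; apply: fibre_pair_IT2.
      by move=> ab; apply: nUb; rewrite -ab; exact: CU.
    move=> U1 U2 oU1 oU2 U1a U2b; apply/set0P/eqP => U120.
    by apply: nU; exists U1, U2.
  have [C1 [aC1 clC1] CU1] := Gsystem_regular sysX (open_nbhs_nbhs (conj oU1 U1a)).
  have [C2 [bC2 clC2] CU2] := Gsystem_regular sysX (open_nbhs_nbhs (conj oU2 U2b)).
  exists (C1 `*` C2); first by exists (C1, C2).
  exists (pi @` C1 `&` pi @` C2); split.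
  - by apply: closedI; exact: extension_closed_image.
  - rewrite -subset0 -U120; apply: interiorS.
    by apply: setISS; exact: image_subset.
  - by move=> c d /= [C1c C2d] pcd; split; [exists c|exists d].
have [|y yC] := extension_image_interior (@open_interior _ C); first by exists u.
have [y' yC' nDy'] : exists2 y', (pi @` C) y' & ~ D y'.
  apply: contrapT => nex; suff : D° y by rewrite D0.
  move: yC; apply: interiorS => _ [x /interior_subset Cx <-].
  by apply: contrapT => nD; apply: nex; exists (pi x) => //; exists x.
have fibU b : pi b = y' -> U b.
  case: yC' nDy' => a Ca <- nDa pba; apply: contrapT => nUb.
  by apply: nDa; exact: (DP a b).
(* The points whose whole fibre lies in [U] form an open set, and the orbit of [z] enters it. *)
have : nbhs y' (~` (pi @` (~` U))).
  apply: open_nbhs_nbhs; split; last by move=> [b nUb /fibU].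
  exact/closed_openC/extension_closed_image/open_closedC.
move=> /(minimal_hit minY z)[s sz].
exists (- s) => b /= pbz; exists (actX s b); last exact: actK.
by apply: contrapT => nU; apply: sz; exists (actX s b) => //; rewrite pi_act pbz.
Qed.

End extensions.

Theorem theorem7p14 (G : topologicalZmodType) (X Y : topologicalType)
  (actX : G -> X -> X) (actY : G -> Y -> Y) (pi : X -> Y) :
  Gsystem actX -> Gsystem actY -> minimal actX -> minimal actY ->
  extension actX actY pi -> tame actX pi ->
  [/\ (highly_proximal actX pi -> proximal_ext actX pi),
      (proximal_ext actX pi <-> equicont_factors_through actX actY pi) &
      (metrizable X \/ (open_map pi /\ metrizable Y) ->
         proximal_ext actX pi -> highly_proximal actX pi)].
Proof.
move=> sysX sysY minX minY extpi tamepi.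
have hp_prox := highly_proximal_proximal sysX (pi := pi).
have prox_fact := proximal_equicont_factors_through sysX sysY extpi.
have fact_hp factX :=
  tame_highly_proximal sysX sysY minX minY extpi factX tamepi.
(* The way from (3) back to (2) leads through (1). *)
split => //; first by split => [//|/fact_hp].
by move=> _ /prox_fact.
Qed.
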